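(* Let $R$ be a profinite ring, $A$ a finite simple $R$-module and $F=\operatorname{End}_R(A)$ (a finite field). Let $K$ be an $A$-generated profinite $R$-module and let $V$ be a vector space over $F$. Then the natural maps $\Theta_K\colon K\to (K^* )^*$, $\Theta_K(b)(\phi)=\phi(b)$, and $\Lambda_V\colon V\to (V^* )^*$, $\Lambda_V(v)(\psi)=\psi(v)$, are isomorphisms (of profinite $R$-modules and of $F$-vector spaces, respectively). The contravariant functors $K\mapsto K^*$ and $V\mapsto V^*$ establish a (contravariant) equivalence between the category of $A$-generated profinite $R$-modules (with continuous $R$-homomorphisms) and the category of vector spaces over $F$ (with $F$-linear maps).
   Context: A profinite $R$-module is a profinite abelian group on which the profinite ring $R$ acts continuously. For a profinite $R$-module $K$, $K^*=\operatorname{Hom}_R(K,A)$ denotes the set of continuous $R$-homomorphisms $K\to A$; it is an $F$-vector space via $\alpha\phi=\alpha\circ\phi$. $K$ is called $A$-generated if $\bigcap_{\phi\in K^*}\operatorname{Ker}\phi=0$. The module $A$ is an $F$-vector space via $\alpha a=\alpha(a)$. For an $F$-vector space $V$, $V^*$ denotes the set of $F$-linear maps $V\to A$, a closed subset of the product $A^V$ (product topology, $A$ discrete), and a profinite $R$-module via $(r\psi)(v)=r\psi(v)$; it is $A$-generated. On morphisms: a continuous $R$-homomorphism $\beta\colon K\to K'$ gives $\beta^*\colon (K')^*\to K^*$, $\phi'\mapsto\phi'\circ\beta$; an $F$-linear map $S\colon V'\to V$ gives $S^*\colon V^*\to (V')^*$, $\psi\mapsto\psi\circ S$. *)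

(* Defs.v *)
From HB Require Import structures.
From mathcomp Require Import all_boot all_algebra finfield.
From mathcomp Require Import all_classical topology.

Set Implicit Arguments.
Unset Strict Implicit.
Unset Printing Implicit Defensive.

Import GRing.Theory.
Local Open Scope classical_set_scope.
Local Open Scope ring_scope.

Record category := Category {
  obj : Type;
  hom : obj -> obj -> Type;
  idm : forall X, hom X X;
  mcomp : forall X Y Z, hom Y Z -> hom X Y -> hom X Z;
  comp1m : forall X Y (f : hom X Y), mcomp (idm Y) f = f;
  compm1 : forall X Y (f : hom X Y), mcomp f (idm X) = f;
  compmA : forall X Y Z T (h : hom Z T) (g : hom Y Z) (f : hom X Y),
    mcomp h (mcomp g f) = mcomp (mcomp h g) f
}.

Definition is_iso (C : category) (X Y : obj C) (f : hom X Y) : Prop :=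
  exists g : hom Y X, mcomp g f = idm X /\ mcomp f g = idm Y.

Record functor (C D : category) := Functor {
  fobj :> obj C -> obj D;
  fmap : forall X Y, hom X Y -> hom (fobj X) (fobj Y);
  fmap1 : forall X, fmap (idm X) = idm (fobj X);
  fmapM : forall X Y Z (g : hom Y Z) (f : hom X Y),
    fmap (mcomp g f) = mcomp (fmap g) (fmap f)
}.

Record contrafunctor (C D : category) := Contrafunctor {
  cobj :> obj C -> obj D;
  cmap : forall X Y, hom X Y -> hom (cobj Y) (cobj X);
  cmap1 : forall X, cmap (idm X) = idm (cobj X);
  cmapM : forall X Y Z (g : hom Y Z) (f : hom X Y),
    cmap (mcomp g f) = mcomp (cmap f) (cmap g)
}.

Definition functor_id (C : category) : functor C C :=
  @Functor C C id (fun _ _ => id) (fun _ => erefl) (fun _ _ _ _ _ => erefl).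

Section ContrafunctorComposition.
Variables (C D B : category) (G : contrafunctor D B) (F : contrafunctor C D).

Let ccomp_map X Y (f : hom X Y) : hom (G (F X)) (G (F Y)) := cmap G (cmap F f).

Let ccomp_map1 X : ccomp_map (idm X) = idm (G (F X)).
Proof. by rewrite /ccomp_map !cmap1. Qed.

Let ccomp_mapM X Y Z (g : hom Y Z) (f : hom X Y) :
  ccomp_map (mcomp g f) = mcomp (ccomp_map g) (ccomp_map f).
Proof. by rewrite /ccomp_map !cmapM. Qed.

Definition contrafunctor_comp : functor C B := Functor ccomp_map1 ccomp_mapM.
End ContrafunctorComposition.

Definition natural (C D : category) (F G : functor C D)
    (eta : forall X, hom (F X) (G X)) : Prop :=
  forall X Y (f : hom X Y), mcomp (eta Y) (fmap F f) = mcomp (fmap G f) (eta X).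

Definition naturally_isomorphic (C D : category) (F G : functor C D) : Prop :=
  exists eta : forall X, hom (F X) (G X),
    natural eta /\ forall X, is_iso (eta X).

Definition contravariant_equivalence (C D : category)
    (F : contrafunctor C D) (G : contrafunctor D C) : Prop :=
  naturally_isomorphic (functor_id C) (contrafunctor_comp G F) /\
  naturally_isomorphic (functor_id D) (contrafunctor_comp F G).

Definition full_subcategory (C : category) (P : obj C -> Prop) : category :=
  @Category {X : obj C | P X} (fun X Y => hom (sval X) (sval Y))
    (fun X => idm (sval X)) (fun _ _ _ g f => mcomp g f)
    (fun _ _ f => comp1m f) (fun _ _ f => compm1 f)
    (fun _ _ _ _ h g f => compmA h g f).

Lemma linear_ext (R : pzRingType) (U V : lmodType R) (f g : {linear U -> V}) :
  f =1 g -> f = g.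
Proof.
case: f => f [[[f0 fD]] [fZ]]; case: g => g [[[g0 gD]] [gZ]] /= /funext fg.
subst g; congr (GRing.Linear.Pack (GRing.Linear.Class _ _)).
- by congr GRing.isNmodMorphism.phant_Build; congr pair; exact: Prop_irrelevance.
- by congr GRing.isScalable.phant_Build; exact: Prop_irrelevance.
Qed.

Definition mkLinear (R : pzRingType) (U V : lmodType R) (f : U -> V)
    (fL : linear f) : {linear U -> V} :=
  HB.pack_for {linear U -> V} f (GRing.isLinear.Build R U V _ f fL).

Section LmodCategory.
Variable R : pzRingType.

Let lid (V : lmodType R) : {linear V -> V} := idfun.
Let lcomp (U V W : lmodType R) (g : {linear V -> W}) (f : {linear U -> V}) :
  {linear U -> W} := g \o f.

Let lcomp1m (U V : lmodType R) (f : {linear U -> V}) : lcomp (lid V) f = f.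
Proof. exact: linear_ext. Qed.
Let lcompm1 (U V : lmodType R) (f : {linear U -> V}) : lcomp f (lid U) = f.
Proof. exact: linear_ext. Qed.
Let lcompA (U V W X : lmodType R) (h : {linear W -> X}) (g : {linear V -> W})
  (f : {linear U -> V}) : lcomp h (lcomp g f) = lcomp (lcomp h g) f.
Proof. exact: linear_ext. Qed.

Definition lmod_category : category := Category lcomp1m lcompm1 lcompA.
End LmodCategory.

(* A topological group (ring, module) is profinite, i.e. an inverse limit of
   finite discrete ones, iff its space is compact, Hausdorff and totally
   disconnected. *)
HB.mixin Record isProfinite T & Topological T := {
  profinite_compact : compact [set: T];
  profinite_hausdorff : hausdorff_space T;
  profinite_disconnected : totally_disconnected [set: T]
}.

HB.structure Definition ProfiniteSpace := {T of Topological T & isProfinite T}.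

(* The topological groups and modules of tvs.v cannot be reused here: the modules
   there only have scalars in a numDomainType. *)
HB.mixin Record isContinuousGroup M & Topological M & GRing.Zmodule M := {
  add_continuous : continuous (fun x : M * M => x.1 + x.2);
  opp_continuous : continuous (fun x : M => - x)
}.

#[short(type="profiniteZmodType")]
HB.structure Definition ProfiniteZmodule :=
  {M of ProfiniteSpace M & GRing.Zmodule M & isContinuousGroup M}.

HB.mixin Record isContinuousMul R & Topological R & GRing.NzRing R := {
  mul_continuous : continuous (fun x : R * R => x.1 * x.2)
}.

#[short(type="profiniteRingType")]
HB.structure Definition ProfiniteRing :=
  {R of ProfiniteZmodule R & GRing.NzRing R & isContinuousMul R}.

HB.mixin Record isContinuousAction (R : profiniteRingType) M
    & Topological M & GRing.Lmodule R M := {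
  action_continuous : continuous (fun z : R * M => z.1 *: z.2)
}.

#[short(type="profiniteModType")]
HB.structure Definition ProfiniteModule (R : profiniteRingType) :=
  {M of ProfiniteZmodule M & GRing.Lmodule R M & isContinuousAction R M}.

HB.mixin Record isSimpleModule (R : nzRingType) A & GRing.Lmodule R A := {
  simple_neq0 : exists a : A, a != 0;
  simple_sub : forall S : {pred A},
    submod_closed S -> (S =i pred1 0) \/ (S =i predT)
}.

HB.structure Definition SimpleModule (R : nzRingType) :=
  {A of GRing.Lmodule R A & isSimpleModule R A}.

(* The topology is Hausdorff, hence discrete on a finite type. *)
#[short(type="finSimpleModType")]
HB.structure Definition FinSimpleModule (R : profiniteRingType) :=
  {A of Finite A & ProfiniteModule R A & isSimpleModule R A}.

Record chom (R : profiniteRingType) (K L : profiniteModType R) := CHom {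
  chom_linear :> {linear K -> L};
  chom_continuous : continuous chom_linear
}.

Section ContinuousHomTheory.
Variable R : profiniteRingType.
Implicit Types K L M N : profiniteModType R.

Lemma chom_ext K L (f g : chom K L) : f =1 g -> f = g.
Proof.
case: f g => [f fc] [g gc] /= /linear_ext fg; subst g.
by congr CHom; exact: Prop_irrelevance.
Qed.

Definition chom_id K : chom K K :=
  @CHom R K K idfun (fun x => @cvg_id _ (nbhs x)).

Definition chom_comp K L M (g : chom L M) (f : chom K L) : chom K M :=
  @CHom R K M (g \o f) (fun x =>
    continuous_comp (@chom_continuous _ _ _ f x) (@chom_continuous _ _ _ g (f x))).

Let chom_comp1m K L (f : chom K L) : chom_comp (chom_id L) f = f.
Proof. exact: chom_ext. Qed.
Let chom_compm1 K L (f : chom K L) : chom_comp f (chom_id K) = f.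
Proof. exact: chom_ext. Qed.
Let chom_compA K L M N (h : chom M N) (g : chom L M) (f : chom K L) :
  chom_comp h (chom_comp g f) = chom_comp (chom_comp h g) f.
Proof. exact: chom_ext. Qed.

Definition profmod_category : category :=
  Category chom_comp1m chom_compm1 chom_compA.
End ContinuousHomTheory.

Section Endomorphisms.
Variables (R : profiniteRingType) (A : finSimpleModType R).

(* F = End_R(A), with composition as product. Since A is finite, its elements
   are finite functions, which makes F a finType. Schur's and Wedderburn's
   theorems below give it the structure of a finFieldType. *)
Record endo := Endo {
  endo_fun :> {ffun A -> A};
  endo_linearb : `[< linear endo_fun >]
}.

HB.instance Definition _ := [isSub for endo_fun].
HB.instance Definition _ := [Finite of endo by <:].

Lemma endo_linear (f : endo) : linear f.
Proof. by apply/asboolP; exact: endo_linearb. Qed.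

Lemma endoP (f g : endo) : f =1 g -> f = g.
Proof. by move=> fg; apply/val_inj/ffunP. Qed.

Definition mkEndo (f : A -> A) (fL : linear f) : endo.
apply: (@Endo (finfun f)); apply/asboolP => r x y.
by rewrite !ffunE fL.
Defined.

Lemma mkEndoE f fL a : @mkEndo f fL a = f a.
Proof. exact: ffunE. Qed.

Lemma endoD (f : endo) x y : f (x + y) = f x + f y.
Proof. by have := endo_linear f 1 x y; rewrite !scale1r. Qed.

Lemma endo0 (f : endo) : f 0 = 0.
Proof. by apply: (@addrI _ (f 0)); rewrite -endoD !addr0. Qed.

Lemma endoZ (f : endo) r x : f (r *: x) = r *: f x.
Proof. by have := endo_linear f r x 0; rewrite endo0 !addr0. Qed.

Fact endo_zero_linear : linear (fun _ : A => 0 : A).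
Proof. by move=> r x y; rewrite scaler0 addr0. Qed.
Fact endo_one_linear : linear (fun a : A => a).
Proof. by []. Qed.
Fact endo_add_linear (f g : endo) : linear (fun a => f a + g a).
Proof. by move=> r x y; rewrite !endo_linear scalerDr addrACA. Qed.
Fact endo_opp_linear (f : endo) : linear (fun a => - f a).
Proof. by move=> r x y; rewrite endo_linear opprD scalerN. Qed.
Fact endo_mul_linear (f g : endo) : linear (fun a => f (g a)).
Proof. by move=> r x y; rewrite !endo_linear. Qed.

Definition endo_zero := mkEndo endo_zero_linear.
Definition endo_one := mkEndo endo_one_linear.
Definition endo_add f g := mkEndo (endo_add_linear f g).
Definition endo_opp f := mkEndo (endo_opp_linear f).
Definition endo_mul f g := mkEndo (endo_mul_linear f g).

Fact endo_addA : associative endo_add.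
Proof. by move=> f g h; apply: endoP => a; rewrite !mkEndoE addrA. Qed.
Fact endo_addC : commutative endo_add.
Proof. by move=> f g; apply: endoP => a; rewrite !mkEndoE addrC. Qed.
Fact endo_add0 : left_id endo_zero endo_add.
Proof. by move=> f; apply: endoP => a; rewrite !mkEndoE add0r. Qed.
Fact endo_addN : left_inverse endo_zero endo_opp endo_add.
Proof. by move=> f; apply: endoP => a; rewrite !mkEndoE addNr. Qed.
HB.instance Definition _ :=
  GRing.isZmodule.Build endo endo_addA endo_addC endo_add0 endo_addN.

Fact endo_mulA : associative endo_mul.
Proof. by move=> f g h; apply: endoP => a; rewrite !mkEndoE. Qed.
Fact endo_mul1 : left_id endo_one endo_mul.
Proof. by move=> f; apply: endoP => a; rewrite !mkEndoE. Qed.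
Fact endo_mulr1 : right_id endo_one endo_mul.
Proof. by move=> f; apply: endoP => a; rewrite !mkEndoE. Qed.
Fact endo_mulDl : left_distributive endo_mul +%R.
Proof. by move=> f g h; apply: endoP => a; rewrite !mkEndoE. Qed.
Fact endo_mulDr : right_distributive endo_mul +%R.
Proof. by move=> f g h; apply: endoP => a; rewrite !mkEndoE endoD. Qed.
Fact endo_one_neq0 : endo_one != 0.
Proof.
have [a a0] := @simple_neq0 R A; apply: contra_neq a0 => one0.
by rewrite -(mkEndoE endo_one_linear a) -[RHS](mkEndoE endo_zero_linear a) [mkEndo _]one0.
Qed.
HB.instance Definition _ := GRing.Zmodule_isNzRing.Build endo
  endo_mulA endo_mul1 endo_mulr1 endo_mulDl endo_mulDr endo_one_neq0.
HB.instance Definition _ := FinRing.isNzRing.Build endo.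

Lemma endo_mulE (f g : endo) a : (f * g) a = f (g a).
Proof. exact: mkEndoE. Qed.
Lemma endo_oneE a : (1 : endo) a = a.
Proof. exact: mkEndoE. Qed.
Lemma endo_addE (f g : endo) a : (f + g) a = f a + g a.
Proof. exact: mkEndoE. Qed.

Lemma endo_domain (f g : endo) : f * g = 0 -> (f == 0) || (g == 0).
Proof.
move=> fg0; pose S : {pred A} := [pred b | [exists a, g a == b]].
have SP b : reflect (exists a, g a = b) (b \in S).
  by apply: (iffP existsP) => -[a /eqP]; exists a => //; apply/eqP.
have Smod : submod_closed S.
  split; first by apply/SP; exists 0; rewrite endo0.
  move=> r _ _ /SP[x <-] /SP[y <-]; apply/SP; exists (r *: x + y).
  by rewrite endo_linear.
case: (simple_sub S Smod) => S_eq.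
  apply/orP; right; apply/eqP/endoP => a; rewrite mkEndoE.
  by apply/eqP; have := S_eq (g a); rewrite [RHS]inE => <-; apply/SP; exists a.
apply/orP; left; apply/eqP/endoP => a; rewrite mkEndoE.
have /SP[b <-] : a \in S by rewrite S_eq.
by rewrite -(mkEndoE (endo_mul_linear f g)) [mkEndo _]fg0 mkEndoE.
Qed.

HB.instance Definition _ :=
  GRing.PzRing_hasCommutativeMul.Build endo (finDomain_mulrC endo_domain).
HB.instance Definition _ :=
  GRing.ComUnitRing_isIntegral.Build endo endo_domain.
HB.instance Definition _ :=
  GRing.UnitRing_isField.Build endo (finDomain_field endo_domain).

(* A as an F-vector space, al *: a = al(a); an alias is needed because A itself
   already carries the scaling by R. *)
Definition evalmod : Type := A.
HB.instance Definition _ := GRing.Zmodule.copy evalmod A.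

Definition evalmod_scale (f : endo) (a : evalmod) : evalmod := f a.
Fact evalmod_scaleA f g a :
  evalmod_scale f (evalmod_scale g a) = evalmod_scale (f * g) a.
Proof. by rewrite /evalmod_scale endo_mulE. Qed.
Fact evalmod_scale1 : left_id 1 evalmod_scale.
Proof. by move=> a; rewrite /evalmod_scale endo_oneE. Qed.
Fact evalmod_scaleDr : right_distributive evalmod_scale +%R.
Proof. by move=> f a b; exact: endoD. Qed.
Fact evalmod_scaleDl a : {morph evalmod_scale^~ a : f g / f + g}.
Proof. by move=> f g; rewrite /evalmod_scale endo_addE. Qed.
HB.instance Definition _ := GRing.Zmodule_isLmodule.Build endo evalmod
  evalmod_scaleA evalmod_scale1 evalmod_scaleDr evalmod_scaleDl.

End Endomorphisms.

Section ModuleDual.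
Variables (R : profiniteRingType) (A : finSimpleModType R).

Lemma finite_open (U : set A) : open U.
Proof.
have acc : accessible_space A.
  exact/hausdorff_accessible/profinite_hausdorff.
rewrite -[U]setCK; apply: closed_openC.
by move/accessible_finite_set_closed: acc; apply; exact: finite_finset.
Qed.

Lemma finite_clopen (U : set A) : clopen U.
Proof.
by split; [|rewrite -[U]setCK; apply: open_closedC]; exact: finite_open.
Qed.

Lemma finite_discrete_continuous (T : topologicalType) (f : A -> T) :
  continuous f.
Proof. by apply/continuousP => U _; exact: finite_open. Qed.

Definition kdual (K : profiniteModType R) : Type := chom K A.

Variable K : profiniteModType R.
Implicit Types phi psi : kdual K.

HB.instance Definition _ := gen_eqMixin (kdual K).
HB.instance Definition _ := gen_choiceMixin (kdual K).

Lemma kdual_ext phi psi : (forall x, phi x = psi x) -> phi = psi.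
Proof. exact: chom_ext. Qed.

Fact kdual_zero_linear : linear (fun _ : K => 0 : A).
Proof. by move=> r x y; rewrite scaler0 addr0. Qed.
Fact kdual_add_linear phi psi : linear (fun x => phi x + psi x).
Proof. by move=> r x y; rewrite !linearP scalerDr addrACA. Qed.
Fact kdual_opp_linear phi : linear (fun x => - phi x).
Proof. by move=> r x y; rewrite linearP opprD scalerN. Qed.
Fact kdual_scale_linear (al : endo A) phi : linear (fun x => al (phi x)).
Proof. by move=> r x y; rewrite linearP endo_linear. Qed.

Fact kdual_zero_continuous : continuous (fun _ : K => 0 : A).
Proof. exact: cst_continuous. Qed.

Fact kdual_add_continuous phi psi : continuous (fun x => phi x + psi x).
Proof.
move=> x; apply: (@continuous_comp K (A * A)%type A (fun x => (phi x, psi x))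
  (fun z => z.1 + z.2)); last exact: add_continuous.
by apply: cvg_pair; exact: chom_continuous.
Qed.

Fact kdual_opp_continuous phi : continuous (fun x => - phi x).
Proof.
move=> x; apply: (@continuous_comp K A A phi (fun a => - a)).
  exact: chom_continuous.
exact: opp_continuous.
Qed.

Fact kdual_scale_continuous (al : endo A) phi :
  continuous (fun x => al (phi x)).
Proof.
move=> x; apply: (@continuous_comp K A A phi al); first exact: chom_continuous.
exact: finite_discrete_continuous.
Qed.

Definition kdual_zero : kdual K :=
  @CHom R K A (mkLinear kdual_zero_linear) kdual_zero_continuous.
Definition kdual_add phi psi : kdual K :=
  @CHom R K A (mkLinear (kdual_add_linear phi psi))
    (@kdual_add_continuous phi psi).
Definition kdual_opp phi : kdual K :=
  @CHom R K A (mkLinear (kdual_opp_linear phi)) (@kdual_opp_continuous phi).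
Definition kdual_scale (al : endo A) phi : kdual K :=
  @CHom R K A (mkLinear (kdual_scale_linear al phi))
    (@kdual_scale_continuous al phi).

Fact kdual_addA : associative kdual_add.
Proof. by move=> f g h; apply: kdual_ext => x /=; rewrite addrA. Qed.
Fact kdual_addC : commutative kdual_add.
Proof. by move=> f g; apply: kdual_ext => x /=; rewrite addrC. Qed.
Fact kdual_add0 : left_id kdual_zero kdual_add.
Proof. by move=> f; apply: kdual_ext => x /=; rewrite add0r. Qed.
Fact kdual_addN : left_inverse kdual_zero kdual_opp kdual_add.
Proof. by move=> f; apply: kdual_ext => x /=; rewrite addNr. Qed.
HB.instance Definition _ := GRing.isZmodule.Build (kdual K)
  kdual_addA kdual_addC kdual_add0 kdual_addN.

Fact kdual_scaleA al be phi :
  kdual_scale al (kdual_scale be phi) = kdual_scale (al * be) phi.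
Proof. by apply: kdual_ext => x /=; rewrite endo_mulE. Qed.
Fact kdual_scale1 : left_id 1 kdual_scale.
Proof. by move=> f; apply: kdual_ext => x /=; rewrite endo_oneE. Qed.
Fact kdual_scaleDr : right_distributive kdual_scale +%R.
Proof. by move=> f g h; apply: kdual_ext => x /=; rewrite endoD. Qed.
Fact kdual_scaleDl phi : {morph kdual_scale^~ phi : f g / f + g}.
Proof. by move=> f g; apply: kdual_ext => x /=; rewrite endo_addE. Qed.
HB.instance Definition _ := GRing.Zmodule_isLmodule.Build (endo A) (kdual K)
  kdual_scaleA kdual_scale1 kdual_scaleDr kdual_scaleDl.

Definition A_generated : Prop :=
  \bigcap_(phi in [set: kdual K]) [set x | phi x = 0] = [set 0].

End ModuleDual.

Section VectorDual.
Variables (R : profiniteRingType) (A : finSimpleModType R).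

Definition vdual (V : lmodType (endo A)) : Type := {linear V -> evalmod A}.

Variable V : lmodType (endo A).
Implicit Types psi phi : vdual V.

HB.instance Definition _ := gen_eqMixin (vdual V).
HB.instance Definition _ := gen_choiceMixin (vdual V).

Definition vdual_fun psi : {ptws V -> A} := fun v => (psi : {linear V -> _}) v.

(* V^* has the subspace topology of A^V, {ptws V -> A} being the product space. *)
HB.instance Definition _ :=
  Topological.copy (vdual V) (initial_topology vdual_fun).

Lemma vdual_ext psi phi :
  (forall v, vdual_fun psi v = vdual_fun phi v) -> psi = phi.
Proof. by move=> e; apply: (@linear_ext _ V (evalmod A)) => v; exact: e v. Qed.

Lemma vdual_fun_continuous : continuous vdual_fun.
Proof. exact: initial_continuous. Qed.

Lemma vdual_ev_continuous v : continuous (fun psi => vdual_fun psi v).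
Proof.
move=> psi.
apply: (@continuous_comp _ {ptws V -> A} A vdual_fun (fun g => g v)).
  exact: vdual_fun_continuous.
exact: (@proj_continuous V (fun=> A) v).
Qed.

Lemma continuous_to_vdual (T : topologicalType) (f : T -> vdual V) :
  (forall v, continuous (fun t => vdual_fun (f t) v)) -> continuous f.
Proof.
move=> fC; apply: continuous_comp_initial => t.
apply/cvg_sup => v; apply: (@continuous_comp_initial _ _ _ _
  (vdual_fun \o f : T -> initial_topology (fun g : {ptws V -> A} => g v))).
exact: fC.
Qed.

Fact vdual_zero_linear : linear (fun _ : V => 0 : evalmod A).
Proof. by move=> al u v; rewrite scaler0 addr0. Qed.
Fact vdual_add_linear psi phi :
  linear (fun v => vdual_fun psi v + vdual_fun phi v : evalmod A).
Proof. by move=> al u v; rewrite /vdual_fun !linearP scalerDr addrACA. Qed.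
Fact vdual_opp_linear psi : linear (fun v => - vdual_fun psi v : evalmod A).
Proof. by move=> al u v; rewrite /vdual_fun linearP opprD scalerN. Qed.
Fact vdual_scale_linear (r : R) psi :
  linear (fun v => r *: vdual_fun psi v : evalmod A).
Proof.
move=> al u v; rewrite /vdual_fun linearP [LHS](@scalerDr _ A).
by congr (_ + _); exact: esym (endoZ al r _).
Qed.

Definition vdual_zero : vdual V := mkLinear vdual_zero_linear.
Definition vdual_add psi phi : vdual V := mkLinear (vdual_add_linear psi phi).
Definition vdual_opp psi : vdual V := mkLinear (vdual_opp_linear psi).
Definition vdual_scale (r : R) psi : vdual V :=
  mkLinear (vdual_scale_linear r psi).

Fact vdual_addA : associative vdual_add.
Proof. by move=> f g h; apply: vdual_ext => x; exact: addrA. Qed.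
Fact vdual_addC : commutative vdual_add.
Proof. by move=> f g; apply: vdual_ext => x; exact: addrC. Qed.
Fact vdual_add0 : left_id vdual_zero vdual_add.
Proof. by move=> f; apply: vdual_ext => x; exact: add0r. Qed.
Fact vdual_addN : left_inverse vdual_zero vdual_opp vdual_add.
Proof. by move=> f; apply: vdual_ext => x; exact: addNr. Qed.
HB.instance Definition _ := GRing.isZmodule.Build (vdual V)
  vdual_addA vdual_addC vdual_add0 vdual_addN.

Fact vdual_scaleA r s psi :
  vdual_scale r (vdual_scale s psi) = vdual_scale (r * s) psi.
Proof. by apply: vdual_ext => x; exact: scalerA. Qed.
Fact vdual_scale1 : left_id 1 vdual_scale.
Proof. by move=> f; apply: vdual_ext => x; exact: scale1r. Qed.
Fact vdual_scaleDr : right_distributive vdual_scale +%R.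
Proof. by move=> r f g; apply: vdual_ext => x; exact: scalerDr. Qed.
Fact vdual_scaleDl psi : {morph vdual_scale^~ psi : r s / r + s}.
Proof. by move=> r s; apply: vdual_ext => x; exact: scalerDl. Qed.
HB.instance Definition _ := GRing.Zmodule_isLmodule.Build R (vdual V)
  vdual_scaleA vdual_scale1 vdual_scaleDr vdual_scaleDl.

Fact vdual_add_continuous : continuous (fun z : vdual V * vdual V => z.1 + z.2).
Proof.
apply: continuous_to_vdual => v z.
apply: (@continuous_comp _ (A * A)%type A
  (fun z : vdual V * vdual V => (vdual_fun z.1 v, vdual_fun z.2 v))
  (fun z => z.1 + z.2)); last exact: add_continuous.
apply: cvg_pair => /=.
- by apply: (@continuous_comp _ _ _ fst (fun psi => vdual_fun psi v));
    [exact: cvg_fst|exact: vdual_ev_continuous].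
- by apply: (@continuous_comp _ _ _ snd (fun psi => vdual_fun psi v));
    [exact: cvg_snd|exact: vdual_ev_continuous].
Qed.

Fact vdual_opp_continuous : continuous (fun psi : vdual V => - psi).
Proof.
apply: continuous_to_vdual => v psi.
apply: (@continuous_comp _ A A (fun psi => vdual_fun psi v) (fun a => - a)).
  exact: vdual_ev_continuous.
exact: opp_continuous.
Qed.
Fact vdual_range_closed : closed (range vdual_fun).
Proof.
have -> : range vdual_fun =
    \bigcap_(z in [set: endo A * (V * V)])
      [set g | g (z.1 *: z.2.1 + z.2.2) = z.1 (g z.2.1) + g z.2.2].
  apply/seteqP; split=> [_ [psi _ <-] [al [u v]] _ /=|g gL].
    by rewrite /vdual_fun linearP.
  have gL' : linear (g : V -> evalmod A).
    by move=> al u v; exact: gL (al, (u, v)) I.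
  by exists (mkLinear gL').
apply: closed_bigI => -[al [u v]] _ /=.
have projC w : continuous (fun g : {ptws V -> A} => g w).
  exact: (@proj_continuous V (fun=> A) w).
rewrite [X in closed X](_ : _ = ~` \bigcup_(x in [set x : A * (A * A) |
    x.1 <> al x.2.1 + x.2.2]) ([set g | g (al *: u + v) = x.1] `&`
    ([set g | g u = x.2.1] `&` [set g | g v = x.2.2]))).
  apply: open_closedC; apply: bigcup_open => -[a [b c]] _ /=.
  have projO w e : open [set g : {ptws V -> A} | g w = e].
    by move/continuousP: (projC w) => /(_ [set e]); apply; exact: finite_open.
  by apply: openI; [|apply: openI]; exact: projO.
apply/seteqP; split=> g /=.
  by move=> ge [[a [b c]]] /= ne [ga [gb gc]]; apply: ne; rewrite -ga -gb -gc.
move=> gn; apply: contrapT => ne; apply: gn.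
by exists (g (al *: u + v), (g u, g v)).
Qed.

Fact vdual_compact : compact [set: vdual V].
Proof.
have rC : compact (range vdual_fun).
  have /= prodC := @tychonoff V (fun=> A) (fun=> setT)
    (fun=> profinite_compact).
  exact: (subclosed_compact vdual_range_closed prodC).
move=> F PF FT; have [|_ [[psi _ <-] clpsi]] := rC (vdual_fun @ F) _.
  by apply: (@filterS _ F _ [set: vdual V]) => // psi _; exists psi.
exists psi; split=> // B C FB [_ [[O oO <-] Opsi OC]].
have [] := clpsi (vdual_fun @` B) O.
- by apply: (@filterS _ F _ B) => // phi Bphi; exists phi.
- exact: open_nbhs_nbhs.
by move=> _ [[phi Bphi <-] Ophi]; exists phi; split=> //; exact: OC.
Qed.

Fact vdual_zero_dimensional : zero_dimensional (vdual V).
Proof.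
move=> psi phi psi_phi.
have [v ne] : exists v, vdual_fun psi v <> vdual_fun phi v.
  by apply/existsNP => e; move/eqP: psi_phi; apply; exact: vdual_ext.
exists ((fun xi => vdual_fun xi v) @^-1` [set vdual_fun psi v]); split=> //.
  apply: preimage_clopen; first exact: finite_clopen.
  exact: vdual_ev_continuous.
exact/nesym.
Qed.

Fact vdual_hausdorff : hausdorff_space (vdual V).
Proof.
move=> psi phi cl; apply: contrapT => /eqP ne.
have [U [[oU cU] Upsi Uphi]] := vdual_zero_dimensional ne.
have [] := cl U (~` U).
- exact: open_nbhs_nbhs.
- by apply: open_nbhs_nbhs; split=> //; exact: closed_openC.
by move=> xi [].
Qed.

HB.instance Definition _ := isProfinite.Build (vdual V) vdual_compact
  vdual_hausdorff (zero_dimension_totally_disconnected vdual_zero_dimensional).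

HB.instance Definition _ := isContinuousGroup.Build (vdual V)
  vdual_add_continuous vdual_opp_continuous.

Fact vdual_action_continuous : continuous (fun z : R * vdual V => z.1 *: z.2).
Proof.
apply: continuous_to_vdual => v z.
apply: (@continuous_comp _ (R * A)%type A
  (fun z : R * vdual V => (z.1, vdual_fun z.2 v))
  (fun z => z.1 *: z.2)); last exact: action_continuous.
apply: cvg_pair => /=; first exact: cvg_fst.
by apply: (@continuous_comp _ _ _ snd (fun psi => vdual_fun psi v));
    [exact: cvg_snd|exact: vdual_ev_continuous].
Qed.
HB.instance Definition _ := isContinuousAction.Build R (vdual V)
  vdual_action_continuous.

End VectorDual.

Section Duality.
Variables (R : profiniteRingType) (A : finSimpleModType R).
Implicit Types (K L M : profiniteModType R) (U V W : lmodType (endo A)).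

Definition generated_category : category :=
  @full_subcategory (profmod_category R) (A_generated A).

Definition vect_category : category := lmod_category (endo A).

Fact kdual_map_linear K L (be : chom K L) :
  linear ((fun phi => chom_comp phi be) : kdual A L -> kdual A K).
Proof. by move=> al phi psi; exact: kdual_ext. Qed.

Definition kdual_map K L (be : chom K L) : {linear kdual A L -> kdual A K} :=
  mkLinear (kdual_map_linear be).

Definition vdual_precomp V W (S : {linear V -> W}) (psi : vdual W) : vdual V :=
  (psi : {linear W -> evalmod A}) \o S.

Fact vdual_precomp_linear V W (S : {linear V -> W}) : linear (vdual_precomp S).
Proof. by move=> r psi phi; exact: vdual_ext. Qed.

Fact vdual_precomp_continuous V W (S : {linear V -> W}) :
  continuous (vdual_precomp S).
Proof. by apply: continuous_to_vdual => v; exact: vdual_ev_continuous. Qed.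

Definition vdual_map V W (S : {linear V -> W}) :
    @chom R (vdual W) (vdual V) :=
  @CHom R (vdual W) (vdual V) (mkLinear (vdual_precomp_linear S))
    (@vdual_precomp_continuous V W S).

Fact keval_linear K b :
  linear ((fun phi => phi b) : kdual A K -> evalmod A).
Proof. by []. Qed.

Definition keval K b : vdual (kdual A K) := mkLinear (@keval_linear K b).

Fact Theta_linear K : linear (@keval K).
Proof. by move=> r x y; apply: vdual_ext => phi; exact: linearP. Qed.

Fact Theta_continuous K : continuous (@keval K).
Proof. by apply: continuous_to_vdual => phi; exact: chom_continuous. Qed.

Definition Theta K : @chom R K (vdual (kdual A K)) :=
  @CHom R K (vdual (kdual A K)) (mkLinear (@Theta_linear K))
    (@Theta_continuous K).

Fact veval_linear V v : linear ((fun psi => vdual_fun psi v) : vdual V -> A).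
Proof. by []. Qed.

Definition veval V v : kdual A (vdual V) :=
  @CHom R (vdual V) A (mkLinear (@veval_linear V v))
    (@vdual_ev_continuous R A V v).

Fact Lambda_linear V : linear (@veval V).
Proof.
move=> al u v; apply: kdual_ext => psi.
exact: (linearP (psi : {linear V -> evalmod A})).
Qed.

Definition Lambda V : {linear V -> kdual A (vdual V)} :=
  mkLinear (@Lambda_linear V).

Lemma ThetaE K b phi : vdual_fun (Theta K b) phi = phi b.
Proof. by []. Qed.

Lemma LambdaE V v (psi : vdual V) : Lambda V v psi = vdual_fun psi v.
Proof. by []. Qed.

Lemma vdual_generated V : A_generated A (vdual V).
Proof.
apply/seteqP; split=> [psi psi0|_ -> phi _]; last exact: linear0.
by apply: vdual_ext => v; exact: (psi0 (Lambda V v) I).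
Qed.

Let kdual_map1 K : kdual_map (chom_id K) = idfun.
Proof. by apply: linear_ext => phi; exact: kdual_ext. Qed.
Let kdual_mapM K L M (g : chom L M) (f : chom K L) :
  kdual_map (chom_comp g f) = kdual_map f \o kdual_map g.
Proof. by apply: linear_ext => phi; exact: kdual_ext. Qed.

Definition kdual_functor : contrafunctor generated_category vect_category :=
  @Contrafunctor generated_category vect_category
    (fun X => kdual A (sval X)) (fun X Y be => kdual_map be)
    (fun X => kdual_map1 (sval X)) (fun X Y Z g f => kdual_mapM g f).

Let vdual_map1 V : vdual_map (idfun : {linear V -> V}) = chom_id (vdual V).
Proof. by apply: chom_ext => psi; exact: vdual_ext. Qed.
Let vdual_mapM U V W (T : {linear V -> W}) (S : {linear U -> V}) :
  vdual_map (T \o S) = chom_comp (vdual_map S) (vdual_map T).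
Proof. by apply: chom_ext => psi; exact: vdual_ext. Qed.

Definition vdual_functor : contrafunctor vect_category generated_category :=
  @Contrafunctor vect_category generated_category
    (fun V => exist _ (vdual V : profiniteModType R) (vdual_generated V))
    (fun V W S => vdual_map S) vdual_map1 (fun U V W T S => vdual_mapM T S).

End Duality.

(* Main.v *)
Require Import Defs.
From mathcomp Require Import all_boot all_algebra.
From HB Require Import structures.
From mathcomp Require Import finmap all_classical topology.

Set Implicit Arguments.
Unset Strict Implicit.
Unset Printing Implicit Defensive.

Import GRing.Theory.
Local Open Scope classical_set_scope.
Local Open Scope ring_scope.

(** Both dualities rest on one fact about finitely many continuous maps
    phi_1, ..., phi_n from K to A: a map phi that vanishes wherever they all
    vanish is an F-combination of them ([kernel_span]). Indeed, for a
    submodule N of K the simplicity of A forces phi_1 to kill N or to map it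
    onto A; in the second case any map vanishing on the kernel of phi_1 in N is
    there an endomorphism of A after phi_1 ([endo_factor]), so that the phi_i
    can be removed one at a time.

    Compactness upgrades finite statements to infinite ones. All the sets cut
    out by conditions on the values phi(x) are clopen, so the finite
    intersection property applies and gives the two surjectivities.
    - An F-linear psi on K* agrees on finitely many phi_i with the evaluation
      at some b in K ([finite_interpolation]), hence with a single evaluation
      everywhere: Theta is onto.
    - A subspace of K* that separates the points of K is all of K*
      ([separating_subspace]): if phi were not in it, then by [kernel_span] the
      finite common kernels of its members would meet the clopen set where phi
      is nonzero, and so would their full intersection, which is 0. Applied to
      the evaluations at vectors, inside the dual of V*, this says that Lambda
      is onto.

    Theta is injective exactly because K is A-generated. Lambda is injective
    because a nonzero vector v spans a line with a complement, by Zorn's lemma,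
    and the coordinate along v then gives a functional that is nonzero at v.
    A bijective continuous homomorphism of profinite modules is an isomorphism,
    being closed, and naturality is a computation on elements. *)

(** * Submodules *)

(** Subspaces of V and of K* as well as R-submodules of K are handled as
    propositional sets, since membership in them is not decidable. *)
Definition submodule (R : pzRingType) (M : lmodType R) (N : set M) : Prop :=
  N 0 /\ forall r x y, N x -> N y -> N (r *: x + y).

Section SubmoduleTheory.
Variables (R : pzRingType) (M : lmodType R) (N : set M).
Hypothesis subN : submodule N.

Lemma submoduleD x y : N x -> N y -> N (x + y).
Proof. by rewrite -[x in x + _]scale1r; exact: subN.2. Qed.

Lemma submoduleZ r x : N x -> N (r *: x).
Proof.
by move=> Nx; rewrite -[_ *: _]addr0; apply: subN.2 => //; exact: subN.1.
Qed.

Lemma submoduleB x y : N x -> N y -> N (x - y).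
Proof.
move=> Nx Ny; apply: submoduleD => //; rewrite -scaleN1r.
exact: submoduleZ.
Qed.

Lemma submodule_residue r c d u x y : N (x - c *: u) -> N (y - d *: u) ->
  N (r *: x + y - (r * c + d) *: u).
Proof.
move=> Nx Ny.
suff -> : r *: x + y - (r * c + d) *: u = r *: (x - c *: u) + (y - d *: u).
  exact: subN.2.
by rewrite scalerDl -scalerA scalerBr opprD addrACA.
Qed.

End SubmoduleTheory.

(** * Finitely many maps to a simple module *)

Section Kernels.
Variables (R : profiniteRingType) (A : finSimpleModType R).
Variable K : profiniteModType R.
Implicit Types (phi : kdual A K) (N : set K) (S : set (kdual A K)).

Lemma common_kernel_submodule (s : seq (kdual A K)) :
  submodule [set x : K | forall phi, phi \in s -> phi x = 0].
Proof.
split=> [phi _|r x y x0 y0 phi sphi]; first exact: linear0.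
by rewrite linearP x0 // y0 // scaler0 addr0.
Qed.

(** The image of a submodule under phi is a submodule of the simple module A. *)
Lemma simple_image phi N : submodule N ->
  (forall x, N x -> phi x = 0) \/ (forall a, exists2 x, N x & phi x = a).
Proof.
move=> [N0 NP].
pose P : {pred A} := [pred a | `[< exists2 x, N x & phi x = a >]].
have PP a : reflect (exists2 x, N x & phi x = a) (a \in P) by exact: asboolP.
have Psub : submod_closed P.
  split; first by apply/PP; exists 0 => //; exact: linear0.
  move=> r _ _ /PP[x Nx <-] /PP[y Ny <-]; apply/PP.
  by exists (r *: x + y); [exact: NP|exact: linearP].
case: (simple_sub P Psub) => PE; [left=> x Nx|right=> a].
  by apply/eqP; have := PE (phi x); rewrite [RHS]inE => <-; apply/PP; exists x.
by apply/PP; rewrite PE.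
Qed.

(** On N the map phi depends only on the value of phi0, so it factors through
    phi0(N), which is all of A. *)
Lemma endo_factor phi0 phi N : submodule N ->
    (forall a, exists2 x, N x & phi0 x = a) ->
    (forall x, N x -> phi0 x = 0 -> phi x = 0) ->
  exists al : endo A, forall x, N x -> phi x = al (phi0 x).
Proof.
move=> subN onto ker.
pose lift a := s2val (cid2 (onto a)).
have Nlift a : N (lift a) by rewrite /lift; case: cid2.
have liftK a : phi0 (lift a) = a by rewrite /lift; case: cid2.
have phiE x : N x -> phi x = phi (lift (phi0 x)).
  move=> Nx; apply/eqP; rewrite -subr_eq0 -linearB; apply/eqP/ker.
    exact: submoduleB.
  by rewrite linearB /= liftK subrr.
have lin : linear (fun a => phi (lift a)).
  move=> r a b; rewrite -linearP [RHS]phiE; last exact: subN.2.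
  by rewrite linearP !liftK.
by exists (mkEndo lin) => x Nx; rewrite mkEndoE phiE.
Qed.

(** A map phi0 of s that kills the common kernel of the others is redundant;
    otherwise phi minus a suitable multiple of phi0 vanishes on that kernel, and
    induction applies. Quantifying over the subspaces S that contain s stands for
    the span of s without explicit coefficients. *)
Lemma kernel_span S (s : seq (kdual A K)) phi : submodule S ->
    (forall phi', phi' \in s -> S phi') ->
    (forall x, (forall phi', phi' \in s -> phi' x = 0) -> phi x = 0) ->
  S phi.
Proof.
move=> subS; elim: s phi => [|phi0 s IH] phi sS phi0s.
  suff -> : phi = 0 by exact: subS.1.
  by apply: kdual_ext => x; exact: phi0s.
have sS' phi' : phi' \in s -> S phi'.
  by move=> sphi'; apply: sS; rewrite inE sphi' orbT.
have subN := common_kernel_submodule s.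
have [kill|onto] := simple_image phi0 subN.
  apply: IH sS' _ => x xs; apply: phi0s => phi'.
  by rewrite inE => /predU1P[->|]; [exact: kill|exact: xs].
have [al alE] : exists al : endo A,
    forall x, (forall phi', phi' \in s -> phi' x = 0) -> phi x = al (phi0 x).
  apply: endo_factor subN onto _ => x xs x0.
  by apply: phi0s => phi'; rewrite inE => /predU1P[->|] //; exact: xs.
(* phi - al phi0 vanishes on the common kernel of s alone. *)
rewrite -(subrK (al *: phi0) phi) addrC; apply: subS.2.
  by apply: sS; rewrite inE eqxx.
apply: IH sS' _ => x xs.
by apply/eqP; rewrite subr_eq0; apply/eqP/alE.
Qed.

(** Given a solution b for s and a further map phi0, either phi0 moves onto A on
    the common kernel of s, and b can be corrected there, or phi0 is in the
    span of s, and linearity of psi makes b a solution for phi0 too. *)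
Lemma finite_interpolation (psi : vdual (kdual A K)) (s : seq (kdual A K)) :
  exists b, forall phi, phi \in s -> phi b = vdual_fun psi phi.
Proof.
elim: s => [|phi0 s [b bE]]; first by exists 0.
have subN := common_kernel_submodule s.
have [kill|onto] := simple_image phi0 subN.
  exists b => phi; rewrite inE => /predU1P[->|]; last exact: bE.
  pose S := [set f : kdual A K | f b = vdual_fun psi f].
  apply: (@kernel_span S s) => //; split.
    by rewrite /S /= /vdual_fun linear0.
  move=> al f g fE gE; rewrite /S /=.
  have -> : vdual_fun psi (al *: f + g) =
      al (vdual_fun psi f) + vdual_fun psi g by exact: linearP.
  by rewrite -fE -gE.
have [m Nm m0] := onto (vdual_fun psi phi0 - phi0 b).
exists (b + m) => phi; rewrite inE linearD => /predU1P[->|sphi].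
  by rewrite m0 addrC subrK.
by rewrite Nm // addr0 bE.
Qed.

End Kernels.

(** * The finite intersection property *)

(** Families are tested on lists; the empty list makes T inhabited, so
    that it can be pointed. *)
Lemma compact_fip (T : topologicalType) (I : choiceType) (D : set I)
    (f : I -> set T) :
    compact [set: T] -> (forall i, D i -> closed (f i)) ->
    (forall s : seq I, (forall i, i \in s -> D i) ->
       exists x, forall i, i \in s -> f i x) ->
  exists x, forall i, D i -> f i x.
Proof.
move=> cT fC fip.
have [x0 _] := fip [::] (fun _ => ltac:(by [])).
pose pT : ptopologicalType := HB.pack T (isPointed.Build T x0).
have : compact [set: pT] by [].
rewrite compact_In0 => /(_ I D f) [||x xf]; last by exists x.
  by exists f => // i _; rewrite setTI.
move=> D' D'D; have [i iD'|x xf] := fip (enum_fset D').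
  by have := D'D i iD'; rewrite inE.
by exists x => i; exact: xf.
Qed.

(** * Compactness arguments in a profinite module *)

Section CompactnessArguments.
Variables (R : profiniteRingType) (A : finSimpleModType R).
Variable K : profiniteModType R.

Lemma kdual_clopen (phi : kdual A K) (B : set A) : clopen (phi @^-1` B).
Proof.
by apply: preimage_clopen; [exact: finite_clopen|exact: chom_continuous].
Qed.

(** If phi were outside S, then no finite part of S would cut its common kernel
    down to a subset of the kernel of phi, and compactness would produce a point
    killed by S but not by phi. *)
Lemma separating_subspace (S : set (kdual A K)) : submodule S ->
    (forall x : K, (forall phi, S phi -> phi x = 0) -> x = 0) ->
  forall phi, S phi.
Proof.
move=> subS sep phi; apply: contrapT => nSphi.
have [x xP] : exists x, forall phi', S phi' ->
    (phi' @^-1` [set 0] `&` phi @^-1` [set~ 0]) x.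
  apply: compact_fip; first exact: profinite_compact.
    by move=> phi' _; apply: closedI; apply kdual_clopen.
  move=> s sS; apply: contrapT => none; apply: nSphi.
  apply: (kernel_span subS sS) => x xs; apply: contrapT => phix.
  by apply: none; exists x => phi' sphi'; split=> //; exact: xs.
have x0 : x = 0 by apply: sep => phi' /xP[].
by have [_] := xP 0 subS.1; apply; rewrite x0 /= linear0.
Qed.

(** A point solving all the equations phi b = psi phi exists because any
    finitely many of them are solvable. *)
Lemma Theta_surjective (psi : vdual (kdual A K)) : exists b, Theta A K b = psi.
Proof.
have [b bE] : exists b, forall phi, [set: kdual A K] phi ->
    (phi @^-1` [set vdual_fun psi phi]) b.
  apply: compact_fip; first exact: profinite_compact.
    by move=> phi _; apply kdual_clopen.
  by move=> s _; exact: finite_interpolation.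
by exists b; apply: vdual_ext => phi; exact: bE.
Qed.

Lemma Theta_injective : A_generated A K -> injective (Theta A K).
Proof.
move=> gen x y xy; apply/eqP; rewrite -subr_eq0; apply/eqP.
suff : [set 0] (x - y) by [].
rewrite -gen => phi _ /=; rewrite linearB /= -!ThetaE xy.
exact: subrr.
Qed.

End CompactnessArguments.

(** * Bijective morphisms are isomorphisms *)

(** The inverse is continuous since a continuous map from a compact space to a
    Hausdorff space is closed. *)
Lemma chom_bij_iso (R : profiniteRingType) (K L : profiniteModType R)
    (f : chom K L) :
  injective f -> (forall y, exists x, f x = y) ->
  @is_iso (profmod_category R) K L f.
Proof.
move=> finj fsurj; pose g y := sval (cid (fsurj y)).
have gK y : f (g y) = y by rewrite /g; case: cid.
have fK x : g (f x) = x by apply: finj; rewrite gK.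
have gL : linear g by move=> r x y; apply: finj; rewrite linearP !gK.
have gC : continuous g.
  apply/continuous_closedP => C cC.
  have -> : g @^-1` C = f @` C.
    apply/seteqP; split=> [y Cgy|_ [x Cx <-]]; first by exists (g y).
    by rewrite /= fK.
  apply: compact_closed; first exact: profinite_hausdorff.
  apply: continuous_compact.
    by apply: continuous_subspaceT; exact: chom_continuous.
  exact: subclosed_compact cC profinite_compact _.
by exists (@CHom R L K (mkLinear gL) gC); split; apply: chom_ext.
Qed.

Lemma linear_bij_iso (R : pzRingType) (U V : lmodType R) (f : {linear U -> V}) :
  injective f -> (forall y, exists x, f x = y) ->
  @is_iso (lmod_category R) U V f.
Proof.
move=> finj fsurj; pose g y := sval (cid (fsurj y)).
have gK y : f (g y) = y by rewrite /g; case: cid.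
have fK x : g (f x) = x by apply: finj; rewrite gK.
have gL : linear g by move=> r x y; apply: finj; rewrite linearP !gK.
by exists (mkLinear gL); split; apply: linear_ext.
Qed.

(** * Separating vectors by functionals *)

(** Take W maximal among the subspaces that avoid v: for u outside W, the
    subspace W + Fu contains v, and solving for u puts it in W + Fv. *)
Lemma line_complement (F : fieldType) (V : lmodType F) (v : V) : v != 0 ->
  exists W : set V, [/\ submodule W, ~ W v &
    forall u, exists c, W (u - c *: v)].
Proof.
(* The empty set is admitted so that the union of the empty chain qualifies. *)
move=> v0; pose P (W : set V) := W !=set0 -> submodule W /\ ~ W v.
have [|W [PW Wmax]] := @Zorn_bigcup V P.
  move=> C CP Ctot [w [X CX Xw]].
  have sub Y y : C Y -> Y y -> submodule Y /\ ~ Y v.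
    by move=> CY Yy; apply: CP => //; exists y.
  split; last by move=> [Y CY Yv]; have [] := sub Y v CY Yv.
  split; first by exists X => //; have [[]] := sub X w CX Xw.
  move=> r x y [Y CY Yx] [Z CZ Zy]; have [YZ|ZY] := Ctot Y Z CY CZ.
    have [[_ ZP] _] := sub Z y CZ Zy.
    by exists Z => //; apply: ZP => //; exact: YZ.
  have [[_ YP] _] := sub Y x CY Yx.
  by exists Y => //; apply: YP => //; exact: ZY.
have W0 : W !=set0.
  apply: contrapT => W0; apply: (Wmax [set 0]); last first.
    move=> _; split; last by move=> /= v00; rewrite v00 eqxx in v0.
    by split=> // r x y -> ->; rewrite scaler0 addr0.
  by split=> [w Ww|/(_ 0 erefl) W00]; case: W0; [exists w|exists 0].
have [subW nWv] := PW W0; exists W; split=> // u; apply: contrapT => nu.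
(* The subspace W + Fu. *)
pose W' : set V := [set w | exists c, W (w - c *: u)].
have WW' : W `<` W'.
  split=> [w Ww|W'W]; first by exists 0; rewrite scale0r subr0.
  by apply: nu; exists 0; rewrite scale0r subr0; apply: W'W; exists 1;
    rewrite scale1r subrr; exact: subW.1.
apply: (Wmax _ WW') => _; split.
  split; first by exists 0; rewrite scale0r subr0; exact: subW.1.
  move=> r x y [c Wc] [d Wd]; exists (r * c + d).
  exact: submodule_residue.
move=> [c Wc]; apply: nu; exists c^-1.
have [c0|c0] := eqVneq c 0; first by move: Wc; rewrite c0 scale0r subr0.
suff -> : u - c^-1 *: v = - c^-1 *: (v - c *: u) by exact: submoduleZ.
by rewrite scaleNr scalerBr scalerA mulVf // scale1r opprB.
Qed.

(** * The evaluation map of a vector space *)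

Section Lambda_iso.
Variables (R : profiniteRingType) (A : finSimpleModType R).
Variable V : lmodType (endo A).

(** The functional sends v to a fixed nonzero element of A and kills a
    complement of the line spanned by v. *)
Lemma nonzero_functional (v : V) : v != 0 ->
  exists psi : vdual V, vdual_fun psi v != 0.
Proof.
move=> v0; have [W [subW nWv Wcompl]] := line_complement v0.
have coordU u c d : W (u - c *: v) -> W (u - d *: v) -> c = d.
  move=> Wc Wd; apply: contrapT => /eqP; rewrite -subr_eq0 => cd; apply: nWv.
  suff -> : v = (c - d)^-1 *: (u - d *: v - (u - c *: v)).
    by apply: submoduleZ => //; exact: submoduleB.
  rewrite opprB [X in _ *: X]addrC addrA subrK -scalerBl scalerA mulVf //.
  by rewrite scale1r.
pose coord u := sval (cid (Wcompl u)).
have coordP u : W (u - coord u *: v) by rewrite /coord; case: cid.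
have [a a0] := @simple_neq0 R A.
have lin : linear (fun u => coord u *: (a : evalmod A)).
  move=> r x y; rewrite scalerA -scalerDl; congr (_ *: _).
  by apply: (@coordU (r *: x + y)) => //; exact: submodule_residue.
exists (mkLinear lin); rewrite /vdual_fun /=.
have -> : coord v = 1.
  by apply: (@coordU v) => //; rewrite scale1r subrr; exact: subW.1.
by rewrite scale1r.
Qed.

Lemma Lambda_injective : injective (@Lambda R A V).
Proof.
move=> u v uv; apply: contrapT => /eqP; rewrite -subr_eq0.
move=> /nonzero_functional[psi /eqP]; apply; rewrite -LambdaE linearB uv.
by rewrite subrr.
Qed.

(** The evaluations at vectors separate the elements of V*, by the definition of
    equality there, and so they exhaust its dual. *)
Lemma Lambda_surjective (phi : kdual A (vdual V)) : exists v, Lambda V v = phi.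
Proof.
have subS : submodule (range (@Lambda R A V)).
  split; first by exists 0 => //; exact: linear0.
  by move=> r _ _ [u _ <-] [v _ <-]; exists (r *: u + v); rewrite ?linearP.
have [psi psi0|v _ <-] := separating_subspace subS _ phi; last by exists v.
by apply: vdual_ext => v; apply: (psi0 (Lambda V v)); exists v.
Qed.

End Lambda_iso.

Theorem theorem4p8 (R : profiniteRingType) (A : finSimpleModType R) :
  (forall K : profiniteModType R, A_generated A K ->
     @is_iso (profmod_category R) _ _ (Theta A K)) /\
  (forall V : lmodType (endo A), @is_iso (vect_category A) _ _ (Lambda V)) /\
  @natural (generated_category A) (generated_category A)
    (functor_id _) (contrafunctor_comp (vdual_functor A) (kdual_functor A))
    (fun X => Theta A (sval X)) /\
  @natural (vect_category A) (vect_category A)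
    (functor_id _) (contrafunctor_comp (kdual_functor A) (vdual_functor A))
    (fun V => Lambda V) /\
  contravariant_equivalence (kdual_functor A) (vdual_functor A).
Proof.
have isoT (K : profiniteModType R) : A_generated A K ->
    @is_iso (profmod_category R) _ _ (Theta A K).
  move=> gen; apply: chom_bij_iso; first exact: Theta_injective.
  exact: Theta_surjective.
have isoL (V : lmodType (endo A)) : @is_iso (vect_category A) _ _ (Lambda V).
  apply: linear_bij_iso; first exact: Lambda_injective.
  exact: Lambda_surjective.
have natT : @natural (generated_category A) (generated_category A)
    (functor_id _) (contrafunctor_comp (vdual_functor A) (kdual_functor A))
    (fun X => Theta A (sval X)).
  by move=> X Y f; apply: chom_ext => b; exact: vdual_ext.
have natL : @natural (vect_category A) (vect_category A)
    (functor_id _) (contrafunctor_comp (kdual_functor A) (vdual_functor A))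
    (fun V => Lambda V).
  by move=> V W f; apply: linear_ext => v; exact: kdual_ext.
split=> //; split=> //; split=> //; split=> //; split.
- exists (fun X => Theta A (sval X)); split=> // X.
  exact: isoT (svalP X).
- by exists (fun V => Lambda V); split.
Qed.
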